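(* Let $K=\mathbb{F}_q$ be a finite field with $q\neq 2$. (a) Let $\mathcal{C}$ be a clutter with vertex set $V_{\mathcal C}$ and edge set $E_{\mathcal C}$, and let $X$ and $Y$ be the sets parameterized by the edges of $\mathcal{C}$ (defined in the context). If there is $A\subset V_{\mathcal C}$ such that $|A\cap e|=1$ for every $e\in E_{\mathcal C}$, then $\delta_Y(d)\leq (q-1)\,\delta_X(d)$ for every $d\geq 1$. (b) Let $G$ be a connected bipartite graph, and let $X$ and $Y$ be the sets parameterized by the edges of $G$. Then $\delta_Y(1)=(q-1)\,\delta_X(1)$.
   Context: A clutter $\mathcal{C}$ is a family $E_{\mathcal C}$ of subsets (edges) of a finite vertex set $V_{\mathcal C}=\{y_1,\ldots,y_n\}$ such that no edge is contained in a different edge; a graph, with vertices and edges defined in the usual way, is a clutter whose edges all have cardinality $2$. A graph is bipartite if its vertex set can be partitioned into two disjoint subsets $V_1$ and $V_2$ such that every edge has one end in $V_1$ and one end in $V_2$. Let $f_1,\ldots,f_s$ be the edges of $\mathcal{C}$ and let $v_i=\sum_{y_j\in f_i}e_j\in\{0,1\}^n$ be the characteristic vector of $f_i$, where $e_j$ is the $j$th unit vector. Put $K^*=K\setminus\{0\}$ and, for $x\in (K^* )^n$, $x^{v_i}=x_1^{v_{i1}}\cdots x_n^{v_{in}}$. Define $X=\{[(x^{v_1},\ldots,x^{v_s})] : x\in (K^* )^n\}\subset\mathbb{P}^{s-1}$ and $Y=\{[(x^{v_1},\ldots,x^{v_s},1)] : x\in (K^* )^n\}\subset\mathbb{P}^{s}$,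 projective spaces over $K$. For a set $Z=\{[P_1],\ldots,[P_r]\}\subset\mathbb{P}^{m-1}$ of $r$ distinct points with all coordinates nonzero, and $d\geq 1$, the parameterized projective code $C_Z(d)$ of degree $d$ on $Z$ is the image of the linear map $K[t_1,\ldots,t_m]_d\to K^{r}$, $f\mapsto\left(f(P_1)/f_0(P_1),\ldots,f(P_r)/f_0(P_r)\right)$, where $f_0=t_1^d$ and $K[t_1,\ldots,t_m]_d$ is the space of homogeneous polynomials of degree $d$ (together with $0$). Its minimum distance is $\delta_Z(d)=\min\{\|v\| : 0\neq v\in C_Z(d)\}$, where $\|v\|$ is the number of nonzero entries of $v$.
   Formalization: In (b) the graph is assumed to have at least two edges: for a single edge the claim fails, since X is one point with δ_X(1)=1 while Y has q−1 points and t_1−t_2 vanishes at exactly one, so δ_Y(1)=q−2. *)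

(* Defs.v *)
From HB Require Import structures.
From mathcomp Require Import all_boot all_order all_algebra.
From mathcomp Require Import mpoly.

Set Implicit Arguments.
Unset Strict Implicit.
Unset Printing Implicit Defensive.

Import GRing.Theory.
Local Open Scope ring_scope.

Section Clutters.
Variable V : finType.
Implicit Types E : {set {set V}}.

Definition clutter E : Prop :=
  forall e e', e \in E -> e' \in E -> e \subset e' -> e = e'.

Definition graph E : Prop := clutter E /\ forall e, e \in E -> #|e| = 2%N.

Definition adjacent E : rel V := fun u v => [set u; v] \in E.

Definition connected_graph E : Prop := forall u v : V, connect (adjacent E) u v.

Definition bipartite E : Prop :=
  exists V1 V2 : {set V}, [/\ V1 :|: V2 = [set: V], [disjoint V1 & V2] &
    forall e, e \in E ->
      exists u v : V, [/\ u \in V1, v \in V2 & e = [set u; v]]].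

Definition edge_enumeration E s (f : s.-tuple {set V}) : Prop :=
  uniq f /\ [set:: f] = E.

End Clutters.

Section ProjectiveCodes.
Variable K : finFieldType.

(* The point [v] of projective space is the equivalence class of v under
   nonzero scaling, i.e. the set of all homogeneous coordinates of the point.
   A subset of P^(m-1) thus has type {set {set 'rV[K]_m}}. *)
Definition proj_point m (v : 'rV[K]_m) : {set 'rV[K]_m} :=
  [set c *: v | c : K & c != 0].

Definition coords m (P : {set 'rV[K]_m}) : 'rV[K]_m := odflt 0 [pick v in P].

Section Code.
Variables (m d : nat) (Z : {set {set 'rV[K]_m.+1}}).

(* f(P) / f_0(P) with f_0 = t_1^d; by proj_evalE below, this does not depend on
   the homogeneous coordinates chosen by coords. *)
Definition proj_eval (f : {mpoly K[m.+1]}) (P : {set 'rV[K]_m.+1}) : K :=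
  f.@[coords P 0] / ('X_0 ^+ d : {mpoly K[m.+1]}).@[coords P 0].

Definition code_map (f : dhomog m.+1 K d) : 'rV[K]_#|Z| :=
  \row_(i < #|Z|) proj_eval f (enum_val i).

Fact code_map_is_linear : linear code_map.
Proof.
move=> c f g; apply/rowP=> i; rewrite !mxE /proj_eval mpoly_of_dhomog_is_linear.
by rewrite mevalD mevalZ mulrDl mulrA.
Qed.

HB.instance Definition _ := GRing.isLinear.Build K (dhomog m.+1 K d)
  'rV[K]_#|Z| _ code_map code_map_is_linear.

Definition proj_code : {vspace 'rV[K]_#|Z|} := limg (linfun code_map).

Definition weight n (v : 'rV[K]_n) : nat := #|[set i | v 0 i != 0]|.

(* All weights are at most #|Z|, so the default value #|Z| of the iterated
   minimum is harmless as soon as the code is nonzero, i.e. as soon as Z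
   contains a point whose coordinates are all nonzero. *)
Definition min_distance : nat :=
  \big[minn/#|Z|]_(v in proj_code | v != 0) weight v.

Lemma proj_evalE (f : dhomog m.+1 K d) (v : 'rV[K]_m.+1) :
  proj_eval f (proj_point v) =
    f.@[v 0] / ('X_0 ^+ d : {mpoly K[m.+1]}).@[v 0].
Proof.
rewrite /proj_eval /coords; case: pickP => [w|/(_ v)]; last first.
  by move/negP; case; apply/imsetP; exists 1; rewrite ?inE ?oner_eq0 ?scale1r.
case/imsetP=> c; rewrite inE => c0 ->.
have hom (g : {mpoly K[m.+1]}) : g \is d.-homog ->
    g.@[(c *: v) 0] = c ^+ d * g.@[v 0].
  move/dhomogP=> hg; rewrite !mevalE mulr_sumr big_seq [RHS]big_seq.
  apply: eq_bigr => a /hg /= da; rewrite mulrCA; congr (_ * _).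
  under eq_bigr do rewrite mxE exprMn.
  by rewrite big_split /= -da mdegE -prodrXr.
have homX : ('X_0 ^+ d : {mpoly K[m.+1]}) \is d.-homog.
  rewrite -[d in d.-homog]mul1n; apply: dhomogMn.
  by rewrite dhomogX /= mdeg1.
rewrite /= !hom ?dhomog_is_dhomog //.
by rewrite -mulf_div divff ?mul1r // expf_neq0.
Qed.

End Code.

Section Parameterized.
Variables (V : finType) (s : nat) (f : s.-tuple {set V}).

(* x^(v_i); the boolean membership test, coerced to nat, is the entry of the
   characteristic vector v_i of the i-th edge. *)
Definition edge_monomial (x : {ffun V -> K}) (i : 'I_s) : K :=
  \prod_(y : V) x y ^+ (y \in tnth f i).

Definition edge_monomials (x : {ffun V -> K}) : 'rV[K]_s :=
  \row_(i < s) edge_monomial x i.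

Definition param_X : {set {set 'rV[K]_s}} :=
  [set proj_point (edge_monomials x) |
    x : {ffun V -> K} & [forall y, x y != 0]].

(* (x^(v_1), ..., x^(v_s), 1): unlift ord_max i is None exactly for the last
   index i. *)
Definition edge_monomials1 (x : {ffun V -> K}) : 'rV[K]_s.+1 :=
  \row_(i < s.+1) oapp (edge_monomial x) 1 (unlift ord_max i).

Definition param_Y : {set {set 'rV[K]_s.+1}} :=
  [set proj_point (edge_monomials1 x) |
    x : {ffun V -> K} & [forall y, x y != 0]].

End Parameterized.

End ProjectiveCodes.

(* Main.v *)
(* Write [q = #|K|].  If [A] meets every edge once, multiplying the coordinates
   of [x] at [A] by [c] multiplies every edge monomial by [c], so [Y], seen as
   the affine set of points [(x^v_1, ..., x^v_s)], is the cone over [X] without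
   its vertex.  Hence a form of degree [d] in [t_1, ..., t_s] has [q - 1] times
   as many nonzeros on [Y] as on [X], which gives (a).

   In (b), a linear form [F = f + b t_(s+1)] with [b != 0] vanishes at most
   once on each line of the cone, so its weight on [Y] is at least
   [(q - 2) / (q - 1) * #|Y| = (q - 2) * #|X|].  This is [q - 1] times the
   weight on [X] of [t_i - t_j] for any edges [f_i != f_j]: rescaling at a
   vertex of [f_i] outside [f_j] shows that this difference is nonzero on
   exactly the fraction [(q - 2) / (q - 1)] of [X].

   Points are counted through their parameters [x]: the parametrizations are
   group morphisms on the torus, so all their fibers have the same size. *)
Require Import Defs.
From mathcomp Require Import all_boot all_order all_algebra.
From mathcomp Require Import mpoly.

Set Implicit Arguments.
Unset Strict Implicit.
Unset Printing Implicit Defensive.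

Import GRing.Theory.

(** * Weights of codewords and the minimum distance *)

Section MinDistance.
Local Open Scope ring_scope.

Lemma weight_eq0 (K : finFieldType) n (v : 'rV[K]_n) :
  (weight v == 0%N) = (v == 0).
Proof.
rewrite cards_eq0; apply/eqP/eqP => [/setP v0|->]; last first.
  by apply/setP => i; rewrite !inE mxE eqxx.
by apply/rowP => i; have := v0 i; rewrite !inE mxE => /negbFE/eqP.
Qed.

Lemma weight_code_map (K : finFieldType) m d (Z : {set {set 'rV[K]_m.+1}})
    (F : dhomog m.+1 K d) :
  weight (code_map Z F) = #|[set P in Z | proj_eval d F P != 0]|.
Proof.
rewrite /weight -(card_imset _ (@enum_val_inj _ (mem Z))).
apply: eq_card => P; rewrite !inE; apply/imsetP/andP => [[i]|[ZP FP]].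
  by rewrite inE mxE => Fi ->; rewrite enum_valP.
by exists (enum_rank_in ZP P); rewrite ?inE ?mxE enum_rankK_in.
Qed.

Variables (K : finFieldType) (m d : nat) (Z : {set {set 'rV[K]_m.+1}}).

Lemma min_distance_le_weight (F : dhomog m.+1 K d) :
  weight (code_map Z F) != 0%N ->
  (min_distance d Z <= weight (code_map Z F))%N.
Proof.
rewrite weight_eq0 => F0; rewrite /min_distance -minEnat -leEnat.
apply: Order.TotalTheory.bigmin_le_cond; rewrite F0 andbT.
by apply/memv_imgP; exists F; rewrite ?memvf ?lfunE.
Qed.

Lemma min_distance_le_card : (min_distance d Z <= #|Z|)%N.
Proof.
by rewrite /min_distance -minEnat -leEnat Order.TotalTheory.bigmin_le_id.
Qed.

(** The default value [#|Z|] of the iterated minimum stays as a case of its own; it is treated later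
    by comparing the cardinalities of [X] and [Y]. *)
Lemma min_distance_cases :
  min_distance d Z = #|Z| \/
  exists2 F : dhomog m.+1 K d, weight (code_map Z F) != 0%N &
    min_distance d Z = weight (code_map Z F).
Proof.
rewrite /min_distance; elim/big_ind: _ => [|a b ha hb|v].
- by left.
- by rewrite /minn; case: ifP.
- case/andP=> /memv_imgP[F _ ->]; rewrite lfunE /= => F0.
  by right; exists F; rewrite ?weight_eq0.
Qed.

End MinDistance.

(** * Homogeneous polynomials: adding a last variable, and linear forms *)

Section Homogeneous.
Local Open Scope ring_scope.
Variables (K : fieldType) (n : nat).

Lemma mwiden_msupp (p : {mpoly K[n]}) :
  mwiden p = \sum_(a <- msupp p) p@_a *: 'X_[mnmwiden a].
Proof.
rewrite {1}[p]mpolyE raddf_sum /=.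
by apply: eq_bigr => a _; rewrite mwidenZ mwidenX.
Qed.

Lemma mwiden_homog d (p : {mpoly K[n]}) :
  p \is d.-homog -> mwiden p \is d.-homog.
Proof.
move=> /dhomogP hp; rewrite mwiden_msupp big_seq.
apply: rpred_sum => a /hp /= da; apply: rpredZ.
rewrite dhomogX /= -da !mdegE big_ord_recr /= mnmwiden_ordmax addn0.
by apply/eqP; apply: eq_bigr => i _; rewrite mnmwiden_widen.
Qed.

Lemma meval_mwiden (p : {mpoly K[n]}) (v : 'I_n.+1 -> K) :
  (mwiden p).@[v] = p.@[fun i => v (lift ord_max i)].
Proof.
rewrite mwiden_msupp {3}[p]mpolyE !raddf_sum /=; apply: eq_bigr => a _.
rewrite !mevalZ !mevalX big_ord_recr /= mnmwiden_ordmax.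
rewrite expr0 mulr1; congr (_ * _); apply: eq_bigr => i _.
rewrite mnmwiden_widen; congr (v _ ^+ _); apply/val_inj.
by rewrite /= /bump leqNgt ltn_ord.
Qed.

Lemma homog1_linear (p : {mpoly K[n]}) : p \is 1.-homog ->
  exists c : 'I_n -> K, forall v, p.@[v] = \sum_(i < n) c i * v i.
Proof.
move/dhomogP=> hp; rewrite [p]mpolyE big_seq.
elim/big_ind: _ => [|p1 p2 [c1 h1] [c2 h2]|a /hp /= /eqP].
- exists (fun=> 0) => v; rewrite meval0.
  by rewrite big1 // => i; rewrite mul0r.
- exists (fun i => c1 i + c2 i) => v; rewrite mevalD h1 h2 -big_split /=.
  by apply: eq_bigr => i _; rewrite mulrDl.
- case/mdeg1P=> j /eqP ->; exists (fun i => p@_(U_(j)) * (i == j)%:R) => v.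
  rewrite mevalZ mevalXU (bigD1 j) //= eqxx mulr1 big1 ?addr0 // => i.
  by move/negPf->; rewrite mulr0 mul0r.
Qed.

Lemma linear_homog1 (c : 'I_n -> K) :
  (\sum_(i < n) c i *: 'X_i : {mpoly K[n]}) \is 1.-homog.
Proof.
by apply: rpred_sum => i _; apply: rpredZ; rewrite dhomogX /= mdeg1.
Qed.

Lemma meval_linear (c : 'I_n -> K) (v : 'I_n -> K) :
  (\sum_(i < n) c i *: 'X_i).@[v] = \sum_(i < n) c i * v i.
Proof.
by rewrite raddf_sum /=; apply: eq_bigr => i _; rewrite mevalZ mevalXU.
Qed.

End Homogeneous.

(** * The torus of parameters, its translations and dilations *)

Section Torus.
Local Open Scope ring_scope.
Variables (K : finFieldType) (V : finType).
Implicit Types (x u : {ffun V -> K}) (B : {set V}).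

Definition torus : {set {ffun V -> K}} :=
  [set x : {ffun V -> K} | [forall y, x y != 0]].

Lemma torusP x : reflect (forall y, x y != 0) (x \in torus).
Proof. by rewrite inE; apply: forallP. Qed.

Definition torus_mul u x : {ffun V -> K} := [ffun y => u y * x y].

Lemma torus_mulP u x : u \in torus -> x \in torus -> torus_mul u x \in torus.
Proof.
by move=> /torusP hu /torusP hx; apply/torusP => y; rewrite ffunE mulf_neq0.
Qed.

Lemma torus_mulI u : u \in torus -> injective (torus_mul u).
Proof.
move=> /torusP hu x x' /ffunP e; apply/ffunP => y.
by have := e y; rewrite !ffunE; apply: mulfI.
Qed.

Lemma imset_torus_mul u : u \in torus -> torus_mul u @: torus = torus.
Proof.
move=> hu; apply/eqP; rewrite eqEcard card_imset ?leqnn ?andbT; last first.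
  exact: torus_mulI.
by apply/subsetP => _ /imsetP[x hx ->]; apply: torus_mulP.
Qed.

Lemma card_torus_gt0 : (0 < #|torus|)%N.
Proof.
apply/card_gt0P; exists [ffun=> 1]; apply/torusP => y.
by rewrite ffunE oner_neq0.
Qed.

Lemma card_torus_mul u (P : pred {ffun V -> K}) : u \in torus ->
  #|[set x in torus | P (torus_mul u x)]| = #|[set x in torus | P x]|.
Proof.
move=> hu; rewrite -(card_imset _ (torus_mulI hu)).
apply: eq_card => z; rewrite [RHS]inE; apply/imsetP/andP => [[x]|[zT Pz]].
  by rewrite inE => /andP[xT Px] ->; rewrite torus_mulP.
move: zT Pz; rewrite -{1}(imset_torus_mul hu) => /imsetP[x xT ->] Px.
by exists x; rewrite // inE xT.
Qed.

(** For [B] a transversal this scales all edge monomials by [c]; for [B] a single vertex, only those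
    of the edges through it. *)
Definition dilation B (c : K) : {ffun V -> K} :=
  [ffun y => if y \in B then c else 1].

Lemma dilation_torus B c : c != 0 -> dilation B c \in torus.
Proof.
by move=> c0; apply/torusP => y; rewrite ffunE; case: ifP; rewrite ?oner_neq0.
Qed.

Definition nonzeros : {set K} := [set~ 0].

Lemma card_nonzeros : #|nonzeros| = (#|K| - 1)%N.
Proof. by rewrite cardsC1 subn1. Qed.

(** Double counting of the pairs [(x, c)]: for each fixed [c] the dilation permutes the torus. *)
Lemma sum_dilation B (P : pred {ffun V -> K}) :
  (\sum_(x in torus)
      #|[set c in nonzeros | P (torus_mul (dilation B c) x)]| =
    (#|K| - 1) * #|[set x in torus | P x]|)%N.
Proof.
transitivity (\sum_(x in torus) \sum_(c in nonzeros)
    P (torus_mul (dilation B c) x))%N.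
  apply: eq_bigr => x _; rewrite -sum1dep_card big_mkcondr.
  by apply: eq_bigr => c _; case: (P _).
rewrite exchange_big /= -card_nonzeros -sum_nat_const; apply: eq_bigr => c.
rewrite !inE => c0; rewrite -(card_torus_mul _ (dilation_torus B c0)).
rewrite -sum1dep_card big_mkcondr.
by apply: eq_bigr => x _; case: (P _).
Qed.

Lemma card_affine_root (a b : K) :
  b != 0 -> (#|K| - 2 <= #|[set c in nonzeros | (c * a + b != 0)%R]|)%N.
Proof.
move=> b0; have -> : (#|K| - 2 = #|nonzeros| - 1)%N.
  by rewrite card_nonzeros -subnDA.
(* The singleton holds the only possible root; for [a = 0] there is none, and the quotient is a
   harmless junk value. *)
rewrite -(cards1 (- b / a)) leq_subLR.
apply: leq_trans (leq_card_setU _ _); apply: subset_leq_card.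
apply/subsetP => c; rewrite !inE => c0; rewrite c0 andTb orbC -implyNb negbK.
apply/implyP => /eqP e; have a0 : a != 0.
  by apply: contraNneq b0 => a0; rewrite -e a0 mulr0 add0r.
by rewrite -[X in X / a]sub0r -(canRL (addrK b) e) mulfK.
Qed.

(** The root [- b / a] is itself nonzero, so exactly one of the [q - 1] candidates is lost. *)
Lemma card_affine_root_eq (a b : K) : a != 0 -> b != 0 ->
  (#|[set c in nonzeros | (c * a + b != 0)%R]| = #|K| - 2)%N.
Proof.
move=> a0 b0; transitivity #|nonzeros :\ (- b / a)|.
  apply: eq_card => c; rewrite !inE andbC addr_eq0; congr (~~ _ && _).
  by apply/eqP/eqP => [<-|->]; rewrite ?mulfK ?divfK.
have := cardsD1 (- b / a) nonzeros.
rewrite card_nonzeros !inE mulf_neq0 ?oppr_eq0 ?invr_eq0 //= => e.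
by rewrite (subnDA 1 _ 1%N) e addKn.
Qed.

(** * Fibers of a multiplicative parametrization *)

Section Parametrization.
Variables (m : nat) (g : {ffun V -> K} -> 'rV[K]_m.+1).
Hypothesis gM : forall u x i, g (torus_mul u x) 0 i = g u 0 i * g x 0 i.
Hypothesis g_neq0 : forall x i, x \in torus -> g x 0 i != 0.

(** The kernel of the morphism from the torus to projective points: nonzero constant vectors
    represent [[1 : ... : 1]]. *)
Definition param_kernel : {set {ffun V -> K}} :=
  [set u in torus | [forall i, g u 0 i == g u 0 0]].

Lemma proj_point_self n (v : 'rV[K]_n) : v \in proj_point v.
Proof. by apply/imsetP; exists 1; rewrite ?inE ?oner_neq0 ?scale1r. Qed.

Lemma proj_pointZ n (v : 'rV[K]_n) (c : K) :
  c != 0 -> proj_point (c *: v) = proj_point v.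
Proof.
move=> c0; apply/setP => w; apply/imsetP/imsetP => -[a]; rewrite inE => a0 ->.
  by exists (a * c); rewrite ?scalerA ?inE ?mulf_neq0.
by exists (a / c); rewrite ?inE ?scalerA ?divfK // mulf_neq0 ?invr_eq0.
Qed.

Lemma proj_point_mul u x : u \in torus -> x \in torus ->
  (proj_point (g (torus_mul x u)) == proj_point (g x)) = (u \in param_kernel).
Proof.
move=> uT xT; rewrite inE uT /=; apply/eqP/forallP => [e i|h].
  have := proj_point_self (g (torus_mul x u)); rewrite e.
  case/imsetP=> c _ /rowP ec.
  have gc j : g u 0 j = c.
    have := ec j; rewrite mxE gM mulrC; apply: mulIf; exact: g_neq0.
  by rewrite !gc.
rewrite -(proj_pointZ (g x) (g_neq0 0 uT)); congr proj_point.
by apply/rowP => i; rewrite mxE gM mulrC (eqP (h i)).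
Qed.

(** Each fiber is a coset of the kernel. For weights, [P] will be the nonvanishing of a form. *)
Lemma card_param_fibers (P : pred {set 'rV[K]_m.+1}) :
  (#|[set x in torus | P (proj_point (g x))]| = #|param_kernel| *
    #|[set p in [set proj_point (g x) | x in torus] | P p]|)%N.
Proof.
set Z := [set p in [set _ | _ in _] | _].
rewrite mulnC -sum_nat_const -sum1dep_card.
rewrite (partition_big (fun x => proj_point (g x)) (mem Z)) /=; last first.
  by move=> x /andP[xT Px]; rewrite !inE Px andbT; apply/imsetP; exists x.
apply: eq_bigr => p; rewrite inE => /andP[/imsetP[x xT ->] Px].
have -> : #|param_kernel| = #|[set u in torus | u \in param_kernel]|.
  by apply: eq_card => u; rewrite !inE andbA andbb.
(* Translation by [x] carries the kernel onto the fiber through [x]. *)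
rewrite -(card_imset _ (torus_mulI xT)) sum1dep_card; apply: eq_card => z.
rewrite inE; apply/andP/imsetP => [[/andP[zT _]]|[u]].
  move: zT; rewrite -{1}(imset_torus_mul xT) => /imsetP[u uT ->].
  by rewrite proj_point_mul // => uk; exists u; rewrite // inE uT.
rewrite inE => /andP[uT uk] ->; have := proj_point_mul uT xT.
by rewrite uk => /eqP e; rewrite torus_mulP // e Px.
Qed.

Lemma card_param :
  (#|torus| = #|param_kernel| * #|[set proj_point (g x) | x in torus]|)%N.
Proof.
have := card_param_fibers predT; rewrite (_ : [set x in torus | _] = torus).
  by move->; congr (_ * _)%N; apply: eq_card => p; rewrite inE andbT.
by apply/setP => x; rewrite inE andbT.
Qed.

Lemma card_param_kernel_gt0 : (0 < #|param_kernel|)%N.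
Proof. by have := card_torus_gt0; rewrite card_param muln_gt0 => /andP[]. Qed.

(** The denominator [t_1^d] has no zero among these points, so only the zeros of [F] matter. *)
Lemma weight_param d (F : dhomog m.+1 K d) :
  (#|param_kernel| *
    weight (code_map [set proj_point (g x) | x in torus] F))%N =
  #|[set x in torus | (F : {mpoly K[m.+1]}).@[g x 0] != 0]|.
Proof.
rewrite weight_code_map -card_param_fibers; apply: eq_card => x; rewrite !inE.
apply: andb_id2l => xT; rewrite proj_evalE mulf_eq0 invr_eq0 negb_or.
rewrite rmorphXn /= mevalXU expf_neq0 ?andbT //.
by apply: g_neq0; rewrite inE.
Qed.

End Parametrization.
End Torus.

(** * Edge monomials as parametrizations of [X] and [Y] *)

Section EdgeMonomials.
Local Open Scope ring_scope.
Variables (K : finFieldType) (V : finType) (s : nat) (f : s.+1.-tuple {set V}).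
Implicit Types (x u : {ffun V -> K}) (A B : {set V}).

Lemma edge_monomialM u x i :
  edge_monomial f (torus_mul u x) i = edge_monomial f u i * edge_monomial f x i.
Proof.
by rewrite -big_split /=; apply: eq_bigr => y _; rewrite ffunE exprMn.
Qed.

Lemma edge_monomial_neq0 x i : x \in torus K V -> edge_monomial f x i != 0.
Proof.
by move/torusP => hx; apply/prodf_neq0 => y _; rewrite expf_neq0.
Qed.

Lemma edge_monomial_dilation B (c : K) i :
  edge_monomial f (dilation B c) i = c ^+ #|B :&: tnth f i|.
Proof.
rewrite -prodr_const [LHS](bigID (mem (B :&: tnth f i))) /=.
rewrite [X in _ * X]big1 ?mulr1 => [|y].
  apply: eq_bigr => y; rewrite inE => /andP[yB yf].
  by rewrite ffunE yB yf expr1.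
rewrite inE ffunE; case: (y \in B) => [/= /negPf->|_]; first exact: expr0.
exact: expr1n.
Qed.

Lemma edge_monomialsM u x i :
  edge_monomials f (torus_mul u x) 0 i =
  edge_monomials f u 0 i * edge_monomials f x 0 i.
Proof. by rewrite !mxE edge_monomialM. Qed.

Lemma edge_monomials_neq0 x i :
  x \in torus K V -> edge_monomials f x 0 i != 0.
Proof. by rewrite mxE; apply: edge_monomial_neq0. Qed.

Lemma edge_monomials1M u x i :
  edge_monomials1 f (torus_mul u x) 0 i =
  edge_monomials1 f u 0 i * edge_monomials1 f x 0 i.
Proof.
by rewrite !mxE; case: unliftP => [j|] _ /=; rewrite ?edge_monomialM ?mulr1.
Qed.

Lemma edge_monomials1_neq0 x i :
  x \in torus K V -> edge_monomials1 f x 0 i != 0.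
Proof.
rewrite mxE; case: unliftP => [j|] _ /= ?; rewrite ?oner_neq0 //.
exact: edge_monomial_neq0.
Qed.

Lemma edge_monomials1_max x : edge_monomials1 f x 0 ord_max = 1.
Proof. by rewrite mxE unlift_none. Qed.

Lemma edge_monomials1_lift x j :
  edge_monomials1 f x 0 (lift ord_max j) = edge_monomials f x 0 j.
Proof. by rewrite !mxE liftK. Qed.

Lemma param_XE :
  param_X K f = [set proj_point (edge_monomials f x) | x in torus K V].
Proof.
apply/setP => p; apply/imsetP/imsetP => -[x xT ->];
  by exists x => //; move: xT; rewrite !inE.
Qed.

Lemma param_YE :
  param_Y K f = [set proj_point (edge_monomials1 f x) | x in torus K V].
Proof.
apply/setP => p; apply/imsetP/imsetP => -[x xT ->];
  by exists x => //; move: xT; rewrite !inE.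
Qed.

(** In [kernel_X] the edge monomials of a parameter are all equal; in [kernel_Y] the last coordinate
    forces them to be 1. *)
Definition kernel_X := param_kernel (edge_monomials (K := K) f).
Definition kernel_Y := param_kernel (edge_monomials1 (K := K) f).

Lemma kernel_Y_gt0 : (0 < #|kernel_Y|)%N.
Proof.
exact: card_param_kernel_gt0 edge_monomials1M edge_monomials1_neq0.
Qed.

Lemma weight_X d (G : dhomog s.+1 K d) :
  (#|kernel_X| * weight (code_map (param_X K f) G))%N =
  #|[set x in torus K V |
      (G : {mpoly K[s.+1]}).@[edge_monomials f x 0] != 0]|.
Proof.
rewrite param_XE.
exact: (weight_param edge_monomialsM edge_monomials_neq0).
Qed.

Lemma weight_Y d (F : dhomog s.+2 K d) :
  (#|kernel_Y| * weight (code_map (param_Y K f) F))%N =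
  #|[set x in torus K V |
      (F : {mpoly K[s.+2]}).@[edge_monomials1 f x 0] != 0]|.
Proof.
rewrite param_YE.
exact: (weight_param edge_monomials1M edge_monomials1_neq0).
Qed.

(** * Edges with a transversal [A]: [Y] as a cone over [X] *)

Section Transversal.
Variable A : {set V}.
Hypothesis hA : forall i, #|A :&: tnth f i| = 1%N.

Lemma edge_monomials_dilation (c : K) x i :
  edge_monomials f (torus_mul (dilation A c) x) 0 i =
  c * edge_monomials f x 0 i.
Proof. by rewrite edge_monomialsM !mxE edge_monomial_dilation hA expr1. Qed.

(* Each [u] with constant monomials has exactly one dilation along [A] whose
   monomials are all 1. *)
Lemma card_kernel_X : (#|kernel_X| = (#|K| - 1) * #|kernel_Y|)%N.
Proof.
pose P u := [forall i, edge_monomials1 f u 0 i == edge_monomials1 f u 0 0].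
have PE u : P u = [forall i, edge_monomials f u 0 i == 1].
  apply/forallP/forallP => h i.
    rewrite -edge_monomials1_lift -(edge_monomials1_max u).
    by rewrite (eqP (h _)) eq_sym h.
  have h1 j : edge_monomials1 f u 0 j = 1.
    case: (unliftP ord_max j) => [k|] ->; last exact: edge_monomials1_max.
    by rewrite edge_monomials1_lift (eqP (h k)).
  by rewrite !h1.
rewrite [kernel_Y]/param_kernel -/P -(sum_dilation A P) -sum1dep_card.
rewrite big_mkcondr /=; apply: eq_bigr => x xT.
have z0 := edge_monomials_neq0 0 xT.
case: ifPn => [/forallP h|].
  rewrite -(cards1 (edge_monomials f x 0 0)^-1); apply: eq_card => c.
  rewrite !inE PE; apply/eqP/andP => [->|[c0 /forallP/(_ 0)]].
    split; first by rewrite invr_eq0.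
    by apply/forallP => i; rewrite edge_monomials_dilation (eqP (h i)) mulVf.
  rewrite edge_monomials_dilation => /eqP e.
  by apply: (mulIf z0); rewrite e mulVf.
(* Dilation along [A] keeps the ratios of monomials, so if two of them differ no [c] makes all of
   them 1. *)
rewrite negb_forall => /existsP[i hi]; symmetry; apply: eq_card0 => c.
rewrite !inE PE; apply/negP => /andP[c0 /forallP h]; move: hi; apply/negP.
rewrite negbK -(inj_eq (mulfI c0)) -!edge_monomials_dilation.
by rewrite (eqP (h i)) eq_sym h.
Qed.

(** The order of the torus factors through [X] and through [Y]; the kernel of [Y] cancels. *)
Lemma card_param_Y : (#|param_Y K f| = (#|K| - 1) * #|param_X K f|)%N.
Proof.
have := card_param edge_monomials1M edge_monomials1_neq0.
rewrite (card_param edge_monomialsM edge_monomials_neq0).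
rewrite -param_XE -param_YE -/kernel_X -/kernel_Y card_kernel_X.
move/eqP; rewrite mulnAC mulnC eqn_pmul2l ?kernel_Y_gt0 //.
by move/eqP.
Qed.

(** Both weights count the same parameters, divided by kernels whose orders have ratio [q - 1]. *)
Lemma weight_param_Y d (F : dhomog s.+2 K d) (G : dhomog s.+1 K d) :
  (forall x, x \in torus K V ->
     ((F : {mpoly K[_]}).@[edge_monomials1 f x 0] != 0) =
     ((G : {mpoly K[_]}).@[edge_monomials f x 0] != 0)) ->
  (weight (code_map (param_Y K f) F) =
     (#|K| - 1) * weight (code_map (param_X K f) G))%N.
Proof.
move=> FG; apply/eqP; rewrite -(eqn_pmul2l kernel_Y_gt0) mulnCA mulnA.
rewrite -card_kernel_X weight_X weight_Y.
apply/eqP; apply: eq_card => x; rewrite [LHS]inE [RHS]inE.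
by apply: andb_id2l; apply: FG.
Qed.

Lemma min_distance_Y_le d :
  (min_distance d (param_Y K f) <= (#|K| - 1) * min_distance d (param_X K f))%N.
Proof.
have q1 : (0 < #|K| - 1)%N by rewrite subn_gt0 card_finNzRing_gt1.
case: (min_distance_cases d (param_X K f)) => [->|[G G0 ->]].
  by rewrite -card_param_Y min_distance_le_card.
(* A form of least weight on [X], read as a form without the last variable. *)
pose F : dhomog s.+2 K d := DHomog (mwiden_homog (dhomog_is_dhomog G)).
have w : (weight (code_map (param_Y K f) F) = (#|K| - 1) *
    weight (code_map (param_X K f) G))%N.
  apply: weight_param_Y => x _; rewrite /= meval_mwiden; congr (_ != 0).
  by apply: meval_eq => i; rewrite edge_monomials1_lift.
by rewrite -w min_distance_le_weight // w muln_eq0 negb_or -lt0n q1.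
Qed.

Lemma edge_monomials1_linear (c : 'I_s.+2 -> K) x :
  \sum_(i < s.+2) c i * edge_monomials1 f x 0 i =
  \sum_(j < s.+1) c (lift ord_max j) * edge_monomials f x 0 j + c ord_max.
Proof.
rewrite (bigD1_ord ord_max) //= edge_monomials1_max mulr1 addrC; congr (_ + _).
by apply: eq_bigr => j _; rewrite edge_monomials1_lift.
Qed.

(* An affine form with nonzero constant term vanishes at most once on each
   orbit under dilation along [A]. *)
Lemma affine_form_weight (F : dhomog s.+2 K 1) (c : 'I_s.+2 -> K) :
  (forall v, (F : {mpoly K[s.+2]}).@[v] = \sum_i c i * v i) ->
  c ord_max != 0 ->
  ((#|K| - 2) * #|torus K V| <=
     (#|K| - 1) * (#|kernel_Y| * weight (code_map (param_Y K f) F)))%N.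
Proof.
move=> Fc c0; rewrite weight_Y -(sum_dilation A) mulnC -sum_nat_const.
apply: leq_sum => x _.
apply: leq_trans (card_affine_root
  (\sum_(j < s.+1) c (lift ord_max j) * edge_monomials f x 0 j) c0) _.
apply: subset_leq_card; apply/subsetP => a; rewrite !inE => /andP[-> h].
rewrite /= Fc edge_monomials1_linear.
under eq_bigr do rewrite edge_monomials_dilation mulrCA.
by rewrite -mulr_sumr.
Qed.

(* [t_i - t_j] vanishes exactly once on each orbit under dilation at [v]. *)
Lemma edge_difference_weight i j v : v \in tnth f i -> v \notin tnth f j ->
  exists G : dhomog s.+1 K 1,
  ((#|K| - 1) * (#|kernel_X| * weight (code_map (param_X K f) G)) =
    (#|K| - 2) * #|torus K V|)%N.
Proof.
move=> vi vj; have hG : ('X_i - 'X_j : {mpoly K[s.+1]}) \is 1.-homog.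
  by apply: rpredB; rewrite dhomogX /= mdeg1.
exists (DHomog hG); rewrite weight_X -(sum_dilation [set v]) mulnC.
rewrite -sum_nat_const; apply: eq_bigr => x xT.
have card_v k : #|[set v] :&: tnth f k| = (v \in tnth f k).
  case: (boolP (v \in _)) => vk; last first.
    apply: eq_card0 => y; rewrite !inE.
    by case: (y =P v) => // ->; apply: negPf.
  by rewrite (setIidPl _) ?cards1 ?sub1set.
(* On the orbit of [x] the difference is [a * x^v_i - x^v_j], affine in the scalar [a] with both
   coefficients nonzero. *)
rewrite -(@card_affine_root_eq _ (edge_monomials f x 0 i)
  (- edge_monomials f x 0 j)) ?oppr_eq0 ?edge_monomials_neq0 //.
apply: eq_card => a; rewrite !inE /= mevalB !mevalXU !edge_monomialsM.
rewrite ![edge_monomials f (dilation _ _) 0 _]mxE !edge_monomial_dilation.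
by rewrite !card_v vi (negPf vj) expr1 expr0 mul1r.
Qed.

Lemma min_distance_Y_ge i j v :
  #|K| <> 2%N -> v \in tnth f i -> v \notin tnth f j ->
  ((#|K| - 1) * min_distance 1 (param_X K f) <= min_distance 1 (param_Y K f))%N.
Proof.
move=> q2 vi vj; have q1 : (1 < #|K|)%N := card_finNzRing_gt1 K.
have q3 : (0 < #|K| - 2)%N by rewrite subn_gt0 ltn_neqAle eq_sym q1; case: eqP.
have q0 : (0 < #|K| - 1)%N by rewrite subn_gt0.
case: (min_distance_cases 1 (param_Y K f)) => [->|[F F0 ->]].
  by rewrite card_param_Y leq_mul2l min_distance_le_card orbT.
have [c Fc] := homog1_linear (dhomog_is_dhomog F).
(* If the last variable is absent, [F] is already a linear form on [X]. *)
have [c0|c0] := eqVneq (c ord_max) 0.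
  pose G : dhomog s.+1 K 1 := DHomog (linear_homog1 (c \o lift ord_max)).
  have w : (weight (code_map (param_Y K f) F) = (#|K| - 1) *
      weight (code_map (param_X K f) G))%N.
    apply: weight_param_Y => x _.
    by rewrite Fc edge_monomials1_linear c0 addr0 meval_linear.
  rewrite w leq_mul2l min_distance_le_weight ?orbT //.
  by apply: contra_neq F0 => G0; rewrite w G0 muln0.
(* Otherwise [F] is compared with [t_i - t_j]. *)
have [G wG] := edge_difference_weight vi vj.
have wFG := affine_form_weight Fc c0.
(* Since [q > 2], the count [(q - 2) * #|torus K V|] is positive, so [t_i - t_j] gives a nonzero
   codeword. *)
have G0 : weight (code_map (param_X K f) G) != 0%N.
  have := card_torus_gt0 K V; apply: contraTneq => G0.
  move: wG; rewrite G0 !muln0.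
  by move/esym/eqP; rewrite muln_eq0 gtn_eqF //= lt0n negbK.
apply: (@leq_trans ((#|K| - 1) * weight (code_map (param_X K f) G))).
  by rewrite leq_mul2l min_distance_le_weight ?orbT.
(* Both estimates share the term [(q - 2) * #|torus K V|]; the common factors [q - 1] and
   [#|kernel_Y|] cancel. *)
move: wFG; rewrite -wG leq_pmul2l // card_kernel_X mulnAC mulnC.
by rewrite leq_pmul2l ?kernel_Y_gt0.
Qed.

End Transversal.
End EdgeMonomials.

(** * Application to clutters and to bipartite graphs *)

Theorem proposition3p10 (K : finFieldType) (hq : #|K| <> 2) :
  (forall (V : finType) (E : {set {set V}}) (s : nat)
      (f : s.+1.-tuple {set V}),
    clutter E -> edge_enumeration E f ->
    (exists A : {set V}, forall e : {set V}, e \in E -> #|A :&: e| = 1) ->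
    forall d : nat, 1 <= d ->
      min_distance d (param_Y K f) <= (#|K| - 1) * min_distance d (param_X K f))
  /\
  (forall (V : finType) (E : {set {set V}}) (s : nat)
      (f : s.+1.-tuple {set V}),
    graph E -> connected_graph E -> bipartite E -> edge_enumeration E f ->
    2 <= #|E| ->
    min_distance 1 (param_Y K f) = (#|K| - 1) * min_distance 1 (param_X K f)).
Proof.
split=> [V E s f _ [_ fE] [A hA] d _|V E s f [Ecl _] _ [V1 [V2 [_ dV hV]]]].
  apply: (@min_distance_Y_le _ _ _ _ A) => i.
  by apply: hA; rewrite -fE inE mem_tnth.
case=> fU fE E2.
have fin i : tnth f i \in E by rewrite -fE inE mem_tnth.
(* One side of the bipartition is a transversal. *)
have hA i : #|V1 :&: tnth f i| = 1.
  have [u [v [uV vV ->]]] := hV _ (fin i).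
  rewrite -(cards1 u); apply: eq_card => y; rewrite !inE.
  case: (y =P u) => [->|_] /=; first by rewrite uV.
  by case: eqP => [->|_]; rewrite ?andbF // (disjointFl dV vV).
(* With at least two edges, index 1 is available beside index 0. *)
have s1 : 1 < s.+1.
  have := card_size f; rewrite size_tuple; apply: leq_trans.
  by apply: leq_trans E2 _; rewrite -fE cardsE.
pose j := Ordinal s1.
(* By the clutter property an inclusion would make the two edges equal, against the injectivity of
   the enumeration. *)
have /subsetPn[v vi vj] : ~~ (tnth f ord0 \subset tnth f j).
  apply/negP => /(Ecl _ _ (fin _) (fin _)).
  by move/(tuple_uniqP f fU)/(congr1 val).
apply/eqP; rewrite eqn_leq (min_distance_Y_le K hA) /=.
exact: (min_distance_Y_ge hA hq vi vj).
Qed.
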